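(* There are superincreasing instances (that is, $r_i>\sum_{j>i}r_j$ for all $i$) on which every descending greedy execution is suboptimal for the cardinality $N(S)=|S|$ over feasible sets $S$. For example, this happens in the plane for the disk pan of radius $R=10$, width $w=4.8$ and radii $\{9.95,\,5.0,\,4.3,\,0.6\}$: every descending greedy execution places exactly $\{9.95,5.0\}$ (so $N=2$; this set has optimal contact area, and no step offers a choice of container), while the set $\{5.0,4.3,0.6\}$ is feasible (so $N=3$ is possible), its three rings fitting in a row in the pan.
   Context: Model. Fix a width $w>0$ and a pan, here a closed disk of radius $R$ in the plane. An inventory is a finite list of radii $r_1>r_2>\dots>r_n>0$; ring $i$ has outer radius $r_i$ and hole radius $\max(0,r_i-w)$. A placement of a set $S$ of rings is a forest: each ring of $S$ has as parent either the pan or another ring of $S$ with $r_{\mathrm{child}}\le r_{\mathrm{parent}}-w$, and the children of each common parent must be packable in the parent's region (the pan, or a disk of radius $r-w$ for the hole of a ring of radius $r$), i.e. closed disks having the children's outer radii can be positioned inside that region with pairwise disjoint interiors. Feasibility depends only on the parent assignment (siblings may be rearranged freely). $S$ is feasible if it has a placement. The contact area of $S$ is $\sum_{i\in S}a(r_i)$ with $a(r)=\pi(r^2-\max(0,r-w)^2)$. A descending greedy execution processes the rings in decreasing radius; when ring $i$ is processed, a container (the pan or the hole of an already placed ring) admits it if the container's current children together with ring $i$ are packable in it; the ring receives some admitting container as its permanent parent (chosen by an arbitrary rule), and is skipped only if no container admits it. *)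

(* Defs.v *)
From HB Require Import structures.
From mathcomp Require Import all_boot all_order all_algebra.
From mathcomp Require Import all_classical all_reals all_analysis.

Set Implicit Arguments.
Unset Strict Implicit.
Unset Printing Implicit Defensive.

Import Order.TTheory GRing.Theory Num.Theory.
Import numFieldNormedType.Exports.
Local Open Scope ring_scope.

(* The product norm that the library puts on K * K is the sup norm, hence the
   explicit Euclidean distance; the topology of K * K is the usual one. *)
Definition euclid_dist (K : realType) (p q : K * K) : K :=
  Num.sqrt ((p.1 - q.1) ^+ 2 + (p.2 - q.2) ^+ 2).

Definition closed_disk (K : realType) (c : K * K) (r : K) : set (K * K) :=
  [set p | euclid_dist p c <= r]%classic.

Definition collinear (K : realType) (A : set (K * K)) : Prop :=
  exists a b e : K, (a != 0 \/ b != 0) /\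
    forall p, A p -> a * p.1 + b * p.2 = e.

Record instance (K : realType) := Instance {
  pan_radius : K;
  width : K;
  radii : seq K }.

Definition valid (K : realType) (I : instance K) : Prop :=
  [/\ 0 < pan_radius I, 0 < width I,
      sorted >%R (radii I) & {in radii I, forall r, 0 < r}].

Definition ring (K : realType) (I : instance K) := 'I_(size (radii I)).

Definition ring_radius (K : realType) (I : instance K) (i : ring I) : K :=
  (radii I)`_i.

Definition hole_radius (K : realType) (w r : K) : K := Num.max 0 (r - w).

(* [None] is the pan, [Some j] is the hole of ring [j]. *)
Definition container (K : realType) (I : instance K) := option (ring I).

Definition region_radius (K : realType) (I : instance K) (c : container I) : K :=
  if c is Some j then hole_radius (width I) (ring_radius j) else pan_radius I.

(* Only the shape of the region matters, so it is centred at the origin. *)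
Definition packing (K : realType) (I : instance K) (rho : K)
    (C : {set ring I}) (x : ring I -> K * K) : Prop :=
  (forall i, i \in C ->
     (closed_disk (x i) (ring_radius i) `<=` closed_disk (0, 0) rho)%classic) /\
  (forall i j, i \in C -> j \in C -> i != j ->
     (interior (closed_disk (x i) (ring_radius i)) `&`
      interior (closed_disk (x j) (ring_radius j)) = set0)%classic).

Definition packable (K : realType) (I : instance K) (rho : K)
    (C : {set ring I}) : Prop :=
  exists x : ring I -> K * K, packing rho C x.

(* [p i] is the parent of ring [i]; it is irrelevant for [i \notin S]. When
   the width is positive, a parent has a strictly larger radius than its
   children, so the parent assignment is acyclic, i.e. a forest. *)
Definition placement (K : realType) (I : instance K) (S : {set ring I})
    (p : ring I -> container I) : Prop :=
  (forall i j, i \in S -> p i = Some j ->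
     j \in S /\ ring_radius i <= ring_radius j - width I) /\
  (forall c : container I, packable (region_radius c) [set i in S | p i == c]).

Definition feasible (K : realType) (I : instance K) (S : {set ring I}) : Prop :=
  exists p : ring I -> container I, placement S p.

Definition contact (K : realType) (w r : K) : K :=
  pi * (r ^+ 2 - hole_radius w r ^+ 2).

Definition contact_area (K : realType) (I : instance K) (S : {set ring I}) : K :=
  \sum_(i in S) contact (width I) (ring_radius i).

Definition superincreasing (K : realType) (I : instance K) : Prop :=
  forall i : ring I, \sum_(j : ring I | (i < j)%N) ring_radius j < ring_radius i.

(* [st i = None]: ring [i] is not placed (not yet processed, or skipped);
   [st i = Some c]: ring [i] is placed with parent [c]. *)
Definition state (K : realType) (I : instance K) := ring I -> option (container I).

Definition placed (K : realType) (I : instance K) (st : state I) : {set ring I} :=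
  [set i | st i != None].

Definition admits (K : realType) (I : instance K) (st : state I)
    (c : container I) (i : ring I) : Prop :=
  (if c is Some j then j \in placed st else true) /\
  packable (region_radius c) (i |: [set j | st j == Some c]).

(* [greedy_run k st]: [st] is reachable after processing rings 0, ..., k - 1.
   The order of the indices is that of decreasing radii in a valid instance. *)
Inductive greedy_run (K : realType) (I : instance K) : nat -> state I -> Prop :=
| greedy_start : greedy_run 0 (fun=> None)
| greedy_place (i : ring I) (st : state I) (c : container I) :
    greedy_run i st -> admits st c i ->
    greedy_run i.+1 (fun j => if j == i then Some c else st j)
| greedy_skip (i : ring I) (st : state I) :
    greedy_run i st -> (forall c, ~ admits st c i) -> greedy_run i.+1 st.

Definition greedy_execution (K : realType) (I : instance K) (st : state I) : Prop :=
  greedy_run (size (radii I)) st.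

Definition greedy_suboptimal (K : realType) (I : instance K) : Prop :=
  forall st : state I, greedy_execution st ->
    exists S : {set ring I}, feasible S /\ (#|placed st| < #|S|)%N.

Definition no_choice (K : realType) (I : instance K) : Prop :=
  forall (i : ring I) (st : state I), greedy_run i st ->
    forall c c' : container I, admits st c i -> admits st c' i -> c = c'.

Definition rings_of (K : realType) (I : instance K) (s : seq K) : {set ring I} :=
  [set i | ring_radius i \in s].

Definition example (K : realType) : instance K :=
  Instance 10 (48 / 10) [:: 995 / 100; 5; 43 / 10; 6 / 10].

(* Main.v *)
Require Import Defs.
From mathcomp Require Import all_boot all_order all_algebra.
From mathcomp Require Import all_classical all_reals all_analysis.
From mathcomp Require Import ring lra.

Import Order.TTheory GRing.Theory Num.Theory.
Import numFieldNormedType.Exports.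
Local Open Scope ring_scope.

(** The geometry enters only through two necessary conditions and one
    sufficient condition for packing disks in a disk of radius [rho]. A single
    disk that fits has radius at most [rho] ([subset_disk_le]); two disks with
    disjoint interiors that both fit have radii of sum at most [rho]
    ([disjoint_disks_le]), because on the line through their centres the
    two outermost points are at distance at least twice that sum, which has to be
    at most the diameter. Conversely, disks centred on a common diameter pack as
    soon as consecutive ones do not overlap ([row_packing]).

    In the example, the ring of radius 9.95 can only lie in the pan, which then
    has room for nothing else, as 9.95 + 0.6 > 10. Its hole has radius 5.15: it
    takes the ring of radius 5, and then nothing else, as 5 + 0.6 > 5.15. The
    other holes have radius at most 0.2 and take nothing at all. So once the
    two largest rings are in place, there is no room left: this is [no_room],
    used in two ways. It determines every greedy execution, by the invariant
    [greedy_run_state], with a single admitting container for each of the two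
    largest rings and none for the others. It also shows that a feasible set
    containing the two largest rings is contained in their pair
    ([feasible_sub_two_largest]); a feasible set missing one of them has a
    smaller contact area by arithmetic, since the contact areas are 72.48,
    24.96, 18.49 and 0.36 times pi. Finally, 5 + 4.3 + 0.6 = 9.9 <= 10, so the
    three smallest rings fit in a row in the pan. *)

(** * Disks in the Euclidean plane *)

Section Disks.
Variable K : realType.
Implicit Types (p q c : K * K) (r s rho : K).

Lemma euclid_dist_ge0 p q : 0 <= euclid_dist p q.
Proof. exact: sqrtr_ge0. Qed.

Lemma sqr_euclid_dist p q :
  euclid_dist p q ^+ 2 = (p.1 - q.1) ^+ 2 + (p.2 - q.2) ^+ 2.
Proof. by rewrite sqr_sqrtr // addr_ge0 // sqr_ge0. Qed.

Lemma euclid_dist_eq p q d : 0 <= d ->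
  (p.1 - q.1) ^+ 2 + (p.2 - q.2) ^+ 2 = d ^+ 2 -> euclid_dist p q = d.
Proof. by move=> d0; rewrite /euclid_dist => ->; rewrite sqrtr_sqr ger0_norm. Qed.

Lemma closed_diskE c r p : 0 <= r ->
  closed_disk c r p <-> (p.1 - c.1) ^+ 2 + (p.2 - c.2) ^+ 2 <= r ^+ 2.
Proof.
move=> r0; rewrite /closed_disk /= -sqr_euclid_dist.
by rewrite ler_pXn2r // nnegrE euclid_dist_ge0.
Qed.

Lemma continuous_euclid_dist c : continuous (fun p => euclid_dist p c).
Proof.
move=> p; apply: (@continuous_comp _ _ _
  (fun p : K * K => (p.1 - c.1) ^+ 2 + (p.2 - c.2) ^+ 2) Num.sqrt);
  last exact: sqrt_continuous.
apply: cvgD.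
  by rewrite expr2; apply: cvgM; apply: cvgB; do ?[exact: cvg_cst]; exact: cvg_fst.
by rewrite expr2; apply: cvgM; apply: cvgB; do ?[exact: cvg_cst]; exact: cvg_snd.
Qed.

(** The distance to [c] is continuous for the product topology, so the open
    Euclidean disk is open. *)
Lemma interior_closed_disk c r p :
  euclid_dist p c < r -> interior (closed_disk c r) p.
Proof.
move=> pr; have nbhs_p := @nbhs_filter (K * K)%type p.
have near_lt := @cvgr_lt _ _ _ nbhs_p _ _ (continuous_euclid_dist c p) _ pr.
by apply: (@filterS _ _ nbhs_p) near_lt => q /= /ltW.
Qed.

(** If the centres were closer, the point dividing the segment between them
    in the ratio [r : s] would be interior to both disks. *)
Lemma interior_disjoint_dist c c' r s : 0 < r -> 0 < s ->
  (interior (closed_disk c r) `&` interior (closed_disk c' s) = set0)%classic ->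
  r + s <= euclid_dist c c'.
Proof.
move=> r0 s0 disj; rewrite leNgt; apply/negP => lt_d.
have rs0 : 0 < r + s by rewrite addr_gt0.
pose t := r / (r + s); pose u := s / (r + s).
have t0 : 0 < t by rewrite divr_gt0.
have u0 : 0 < u by rewrite divr_gt0.
have rE : r = t * (r + s) by rewrite /t divfK // gt_eqF.
have sE : s = u * (r + s) by rewrite /u divfK // gt_eqF.
have tu : t + u = 1 by rewrite /t /u -mulrDl divff // gt_eqF.
pose z := (u * c.1 + t * c'.1, u * c.2 + t * c'.2).
suff : (interior (closed_disk c r) `&` interior (closed_disk c' s))%classic z.
  by rewrite disj.
have uE : u = 1 - t by lra.
have zc : euclid_dist z c = t * euclid_dist c c'.
  apply: euclid_dist_eq; first by rewrite mulr_ge0 ?euclid_dist_ge0 // ltW.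
  by rewrite exprMn sqr_euclid_dist /z uE /=; ring.
have zc' : euclid_dist z c' = u * euclid_dist c c'.
  apply: euclid_dist_eq; first by rewrite mulr_ge0 ?euclid_dist_ge0 // ltW.
  by rewrite exprMn sqr_euclid_dist /z uE /=; ring.
split; apply: interior_closed_disk.
  by rewrite zc [ltRHS]rE ltr_pM2l.
by rewrite zc' [ltRHS]sE ltr_pM2l.
Qed.

(** A chord is at most a diameter, by the parallelogram law. *)
Lemma chord_le c rho p q : 0 <= rho ->
  closed_disk c rho p -> closed_disk c rho q -> euclid_dist p q <= 2 * rho.
Proof.
move=> rho0 /closed_diskE-/(_ rho0) cp /closed_diskE-/(_ rho0) cq.
rewrite -(@ler_pXn2r _ 2) ?nnegrE ?euclid_dist_ge0 ?mulr_ge0 //.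
rewrite sqr_euclid_dist.
have := sqr_ge0 ((p.1 - c.1) + (q.1 - c.1)).
have := sqr_ge0 ((p.2 - c.2) + (q.2 - c.2)).
lra.
Qed.

(** A diameter of the small disk is a chord of the large one. *)
Lemma subset_disk_le c c' r rho : 0 < r -> 0 <= rho ->
  (closed_disk c r `<=` closed_disk c' rho)%classic -> r <= rho.
Proof.
move=> r0 rho0 sub; have r0' := ltW r0.
have ep : closed_disk c r (c.1 + r, c.2) by apply/closed_diskE => //=; lra.
have em : closed_disk c r (c.1 - r, c.2) by apply/closed_diskE => //=; lra.
have := chord_le _ _ _ _ rho0 (sub _ ep) (sub _ em).
rewrite -(@ler_pXn2r _ 2) ?nnegrE ?euclid_dist_ge0 ?mulr_ge0 //.
rewrite sqr_euclid_dist /= => h.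
rewrite -(@ler_pXn2r _ 2) ?nnegrE //; lra.
Qed.

(** Extending the segment between the centres by [r] and [s] beyond its ends
    gives a chord of length [d + r + s >= 2 * (r + s)], where [d] is the distance
    between the centres. *)
Lemma disjoint_disks_le c c1 c2 r s rho : 0 < r -> 0 < s -> 0 <= rho ->
  (closed_disk c1 r `<=` closed_disk c rho)%classic ->
  (closed_disk c2 s `<=` closed_disk c rho)%classic ->
  (interior (closed_disk c1 r) `&` interior (closed_disk c2 s) = set0)%classic ->
  r + s <= rho.
Proof.
move=> r0 s0 rho0 sub1 sub2 /(interior_disjoint_dist _ _ _ _ r0 s0).
set d := euclid_dist c1 c2 => le_d.
have d0 : 0 < d by lra.
have dn0 : d != 0 by rewrite gt_eqF.
(* The unit vector from the second centre to the first. *)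
pose e1 := (c1.1 - c2.1) / d; pose e2 := (c1.2 - c2.2) / d.
have e1E : c1.1 = c2.1 + d * e1 by rewrite /e1; field.
have e2E : c1.2 = c2.2 + d * e2 by rewrite /e2; field.
have unit : e1 ^+ 2 + e2 ^+ 2 = 1.
  rewrite /e1 /e2 !expr_div_n -mulrDl -sqr_euclid_dist -/d divff //.
  by rewrite expf_neq0.
have p1 : closed_disk c1 r (c1.1 + r * e1, c1.2 + r * e2).
  apply/closed_diskE; first exact: ltW.
  rewrite /= [leLHS](_ : _ = r ^+ 2 * (e1 ^+ 2 + e2 ^+ 2)); last by ring.
  by rewrite unit mulr1.
have p2 : closed_disk c2 s (c2.1 - s * e1, c2.2 - s * e2).
  apply/closed_diskE; first exact: ltW.
  rewrite /= [leLHS](_ : _ = s ^+ 2 * (e1 ^+ 2 + e2 ^+ 2)); last by ring.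
  by rewrite unit mulr1.
have := chord_le _ _ _ _ rho0 (sub1 _ p1) (sub2 _ p2).
have -> : euclid_dist (c1.1 + r * e1, c1.2 + r * e2)
                      (c2.1 - s * e1, c2.2 - s * e2) = d + r + s.
  apply: euclid_dist_eq; first by lra.
  rewrite /= e1E e2E.
  rewrite [LHS](_ : _ = (d + r + s) ^+ 2 * (e1 ^+ 2 + e2 ^+ 2)); last by ring.
  by rewrite unit mulr1.
lra.
Qed.

Lemma disk_on_axis_subset a r rho : 0 <= r -> `|a| + r <= rho ->
  (closed_disk (a, 0) r `<=` closed_disk (0, 0) rho)%classic.
Proof.
move=> r0 arho p /closed_diskE-/(_ r0) /= pa.
have rho0 : 0 <= rho by apply: le_trans arho; rewrite addr_ge0.
apply/closed_diskE => //=; rewrite !subr0 in pa *.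
have pr : `|p.1 - a| <= r.
  rewrite -(@ler_pXn2r _ 2) ?nnegrE // real_normK ?num_real //.
  by apply: le_trans pa; rewrite lerDl sqr_ge0.
apply: (@le_trans _ _ ((`|a| + r) ^+ 2)); last first.
  by rewrite ler_pXn2r // nnegrE addr_ge0.
have : a * (p.1 - a) <= `|a| * r.
  by apply: le_trans (ler_norm _) _; rewrite normrM ler_wpM2l.
have := @real_normK _ a (num_real a); lra.
Qed.

Lemma closed_disk_bounds c r p : 0 <= r -> closed_disk c r p ->
  c.1 - r <= p.1 <= c.1 + r.
Proof.
move=> r0 /closed_diskE-/(_ r0) h.
suff : `|p.1 - c.1| <= r by rewrite ler_norml => /andP[? ?]; apply/andP; split; lra.
rewrite -(@ler_pXn2r _ 2) ?nnegrE // real_normK ?num_real //.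
by apply: le_trans h; rewrite lerDl sqr_ge0.
Qed.

(** A vertical line separates the two closed disks, which therefore meet at
    most on that line. A common interior point could be moved slightly to the
    right while staying in both disks, crossing the line. *)
Lemma interior_disks_disjoint c c' r s : 0 <= r -> 0 <= s ->
  c.1 + r <= c'.1 - s ->
  (interior (closed_disk c r) `&` interior (closed_disk c' s) = set0)%classic.
Proof.
move=> r0 s0 sep; rewrite -interiorI -subset0 => p /= /nbhs_ballP[e /= e0 sub].
(* A ball of the product is a square, so it contains this horizontal shift. *)
have pe : ball p e (p.1 + e / 2, p.2).
  split => /=; last exact: ballxx.
  rewrite /ball /= opprD addrA subrr add0r normrN gtr0_norm ?divr_gt0 //; lra.
have [_ /(closed_disk_bounds _ _ _ s0) /andP[lb _]] := sub _ (ballxx p e0).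
have [/(closed_disk_bounds _ _ _ r0) /andP[_ ub] _] := sub _ pe.
move: ub lb; rewrite /=; lra.
Qed.

End Disks.

(** * Necessary and sufficient conditions for packing rings *)

Section Packings.
Variables (K : realType) (I : instance K).
Implicit Types (rho : K) (C S : {set ring I}) (i j : ring I).

Lemma packable_le rho C i : packable rho C -> i \in C ->
  0 <= rho -> 0 < ring_radius i -> ring_radius i <= rho.
Proof.
by move=> [x [sub _]] iC rho0 r0; apply: subset_disk_le r0 rho0 (sub i iC).
Qed.

Lemma packable_pair_le rho C i j : packable rho C ->
  i \in C -> j \in C -> i != j ->
  0 <= rho -> 0 < ring_radius i -> 0 < ring_radius j ->
  ring_radius i + ring_radius j <= rho.
Proof.
move=> [x [sub disj]] iC jC ij rho0 ri0 rj0.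
exact: disjoint_disks_le ri0 rj0 rho0 (sub i iC) (sub j jC) (disj i j iC jC ij).
Qed.

(** Being pairwise apart suffices: the row needs no order on [C], because each
    pair is separated by its own vertical line. *)
Lemma row_packing rho C (a : ring I -> K) :
  {in C, forall i, 0 <= ring_radius i} ->
  {in C, forall i, `|a i| + ring_radius i <= rho} ->
  {in C &, forall i j, i != j -> ring_radius i + ring_radius j <= `|a i - a j|} ->
  packing rho C (fun i => (a i, 0)).
Proof.
move=> r0 inside apart; split=> [i iC | i j iC jC ij].
  by apply: disk_on_axis_subset; [exact: r0 | exact: inside].
have ri0 := r0 i iC; have rj0 := r0 j jC.
have [aij|aij] := leP (a i) (a j).
  have := apart i j iC jC ij; rewrite distrC ger0_norm ?subr_ge0 // => sep.
  by apply: interior_disks_disjoint => //=; lra.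
have := apart i j iC jC ij; rewrite gtr0_norm ?subr_gt0 // => sep.
by rewrite setIC; apply: interior_disks_disjoint => //=; lra.
Qed.

Lemma packable0 rho : packable rho (@finset.set0 (ring I)).
Proof. by exists (fun=> (0, 0)); split=> i; rewrite finset.inE. Qed.

Lemma packable1 rho i : 0 <= ring_radius i -> ring_radius i <= rho ->
  packable rho [set i]%SET.
Proof.
move=> r0 rrho; exists (fun=> (0, 0)).
apply: (@row_packing rho [set i]%SET (fun=> 0)).
- by move=> j /finset.set1P ->.
- by move=> j /finset.set1P ->; rewrite normr0 add0r.
- by move=> j k /finset.set1P -> /finset.set1P ->; rewrite eqxx.
Qed.

End Packings.

(** * The example with radii 9.95, 5, 4.3 and 0.6 *)

Section Example.
Variable K : realType.
Local Notation E := (example K).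
Implicit Types (i j : ring E) (c : container E) (st : state E) (T : {set ring E}).

Definition ring0 : ring E := Ordinal (isT : (0 < 4)%N).
Definition ring1 : ring E := Ordinal (isT : (1 < 4)%N).

Local Notation two_largest := [set i : ring E | (i < 2)%N]%SET.
Local Notation all_but_largest := [set i : ring E | (0 < i)%N]%SET.

Lemma ring_eqE i j : (i == j) = (i == j :> nat).
Proof. by []. Qed.

Lemma ring_radius_gt0 i : 0 < ring_radius i.
Proof. by case: i => [[|[|[|[|//]]]] ?] /=; rewrite /ring_radius /=; lra. Qed.

Lemma ring_radius_ge i : 6 / 10 <= ring_radius i.
Proof. by case: i => [[|[|[|[|//]]]] ?]; rewrite /ring_radius /=; lra. Qed.

Lemma hole_radius0 : hole_radius (width E) (ring_radius ring0) = 515 / 100.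
Proof. by rewrite /hole_radius /ring_radius /= max_r; lra. Qed.

Lemma region_radius_ge0 c : 0 <= region_radius c.
Proof. by case: c => [j|]; rewrite /= ?/hole_radius ?le_max ?lexx //; lra. Qed.

(** 9.95 + 0.6 > 10. *)
Lemma pan_full C i : @packable K E (pan_radius E) C ->
  ring0 \in C -> i \in C -> i = ring0.
Proof.
move=> pk C0 Ci; apply/eqP/negPn/negP => i0.
have := packable_pair_le _ _ _ _ _ _ pk Ci C0 i0 (region_radius_ge0 None)
  (ring_radius_gt0 _) (ring_radius_gt0 _).
by case: i i0 {Ci} => [[|[|[|[|//]]]] ?] //=; rewrite /ring_radius /=; lra.
Qed.

(** 5 + 0.6 > 5.15. *)
Lemma hole0_full C i :
  @packable K E (hole_radius (width E) (ring_radius ring0)) C ->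
  ring1 \in C -> i \in C -> (i <= 1)%N.
Proof.
move=> pk C1 Ci; rewrite leqNgt; apply/negP => small_i.
have i1 : i != ring1 by rewrite ring_eqE gtn_eqF.
have := packable_pair_le _ _ _ _ _ _ pk Ci C1 i1 (region_radius_ge0 (Some ring0))
  (ring_radius_gt0 _) (ring_radius_gt0 _).
by rewrite hole_radius0; have := ring_radius_ge i; rewrite /ring_radius /=; lra.
Qed.

(** The smallest radius is 0.6, and only the largest ring has a hole of radius
    more than 0.2. *)
Lemma hole_empty C i j : (0 < j)%N ->
  @packable K E (hole_radius (width E) (ring_radius j)) C -> i \notin C.
Proof.
move=> j0 pk; apply/negP => Ci.
have := packable_le _ _ _ _ _ pk Ci (region_radius_ge0 (Some j)) (ring_radius_gt0 _).
have i6 := ring_radius_ge i.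
have : hole_radius (width E) (ring_radius j) <= 2 / 10.
  by case: j j0 {pk} => [[|[|[|[|//]]]] ?] //= _;
    rewrite /hole_radius /ring_radius /= ge_max; apply/andP; split; lra.
lra.
Qed.

(** Here [C] is meant to be the set of children of [c], and the last hypothesis
    says that the largest ring lies in the pan; it is phrased so as to apply to a
    partial greedy state as well as to a placement. *)
Lemma parent_ring1 c C : packable (region_radius c) C -> ring1 \in C ->
  (c = None -> ring0 \in C) -> c = Some ring0.
Proof.
case: c => [j|] pk C1 h; last by have := pan_full _ _ pk (h erefl) C1.
have [j0|/(hole_empty _ ring1)-/(_ _ pk)] := posnP j; last by rewrite C1.
by congr Some; apply: val_inj.
Qed.

(** The obstruction shared by greedy executions and arbitrary placements: each
    container either is too small or already has a child that fills it up. *)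
Lemma no_room c C i : (1 < i)%N -> packable (region_radius c) C ->
  (c = None -> ring0 \in C) -> (c = Some ring0 -> ring1 \in C) -> i \notin C.
Proof.
move=> small_i; case: c => [j|] pk h0 h1; apply/negP => Ci.
  have [j0|/(hole_empty _ i)-/(_ _ pk)] := posnP j; last by rewrite Ci.
  have jE : j = ring0 by apply: val_inj.
  rewrite jE in pk h1.
  by have := hole0_full _ _ pk (h1 erefl) Ci; rewrite leqNgt small_i.
by have := pan_full _ _ pk (h0 erefl) Ci => iE; rewrite iE in small_i.
Qed.

Definition greedy_parent i : container E :=
  if i == ring0 then None else Some ring0.

(** The invariant of all greedy runs: only the two largest rings ever get a
    parent, so the state stops changing at [k = 2]. *)
Definition greedy_state (k : nat) : state E :=
  fun i => if (i < minn k 2)%N then Some (greedy_parent i) else None.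

Lemma packable_greedy_parent i : (i < 2)%N ->
  packable (region_radius (greedy_parent i)) [set i]%SET.
Proof.
move=> i2; apply: packable1; first exact/ltW/ring_radius_gt0.
case: i i2 => [[|[|//]] lti] _; rewrite /greedy_parent ring_eqE /=.
  by rewrite /ring_radius /=; lra.
by rewrite hole_radius0 /ring_radius /=; lra.
Qed.

(** The first ring has only the pan to go to, the second one finds the pan full
    and only the hole of the first, and the others find no room at all. *)
Lemma admits_greedy_state i st c : st =1 greedy_state i ->
  admits st c i <-> (i < 2)%N /\ c = greedy_parent i.
Proof.
move=> stE; split=> [[placed_c pk]|[i2 ->]].
  (* In [greedy_state i] the earlier large rings are already in place, which is
     what [parent_ring1] and [no_room] ask for. *)
  have in0 : (0 < i)%N -> c = None -> ring0 \in (i |: [set j | st j == Some c])%SET.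
    by move=> i0 ->; rewrite !finset.inE stE /greedy_state /= leq_min i0 orbT.
  have in1 : (1 < i)%N -> c = Some ring0 ->
      ring1 \in (i |: [set j | st j == Some c])%SET.
    by move=> i1 ->; rewrite !finset.inE stE /greedy_state /= leq_min i1 orbT.
  have ini : i \in (i |: [set j | st j == Some c])%SET by rewrite finset.setU11.
  have [small_i|] := ltnP 1 i.
    have := no_room _ _ _ small_i pk (in0 (ltnW small_i)) (in1 small_i).
    by rewrite ini.
  move=> i1; split => //; rewrite /greedy_parent; case: eqVneq => [i0|in0'].
    case: c placed_c {pk in0 in1 ini} => [j|//].
    by rewrite finset.inE stE /greedy_state i0 /=.
  have i0 : (0 < i)%N by rewrite lt0n; apply: contraNneq in0' => ?; apply/eqP/val_inj.
  have iE : i = ring1 by apply: val_inj; apply/eqP; rewrite eqn_leq i1 i0.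
  by apply: (parent_ring1 _ _ pk); [rewrite -iE | exact: in0].
split.
  rewrite /greedy_parent; case: eqVneq => // i0.
  rewrite finset.inE stE /greedy_state leq_min /= lt0n.
  by have -> : nat_of_ord i != 0%N by apply: contraNneq i0 => ?; apply/eqP/val_inj.
have -> : (i |: [set j | st j == Some (greedy_parent i)] = [set i])%SET.
  apply/setP => j; rewrite !finset.inE; case: eqVneq => //= ji.
  rewrite stE /greedy_state (minn_idPl _); last exact: ltnW.
  apply/negP; case: ifP => // ltji /eqP[].
  have : (j < 1)%N by apply: leq_trans ltji _; rewrite -ltnS.
  rewrite ltnS leqn0 => /eqP j0.
  have -> : greedy_parent j = None by rewrite /greedy_parent ring_eqE /= j0.
  rewrite /greedy_parent ring_eqE /=; case: eqP => // i0 _.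
  by move: ltji; rewrite i0.
exact: packable_greedy_parent.
Qed.

(** By [admits_greedy_state], each step is forced in the state reached by the
    previous ones; in particular a skip is impossible before index 2. *)
Lemma greedy_run_state k st : greedy_run k st -> st =1 greedy_state k.
Proof.
elim=> {k st} [|i st c _ IH|i st _ IH noc] //.
- move=> /(admits_greedy_state _ _ _ IH)[i2 ->] j.
  case: eqVneq => [->|ji]; first by rewrite /greedy_state leq_min ltnSn i2.
  rewrite IH /greedy_state !leq_min [(j < i.+1)%N]ltnS (leq_eqVlt j i).
  by rewrite -ring_eqE (negbTE ji).
- move=> j; rewrite IH /greedy_state !leq_min.
  have [i2|i2] := ltnP i 2; last first.
    have [j2|j2] := ltnP j 2; last by rewrite !andbF.
    by rewrite (leq_trans j2 i2) (leq_trans j2 (leqW i2)).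
  by have [] := noc (greedy_parent i); apply/admits_greedy_state.
Qed.

Lemma greedy_no_choice : no_choice E.
Proof.
move=> i st /greedy_run_state stE c c'.
by move=> /(admits_greedy_state _ _ _ stE)[_ ->] /(admits_greedy_state _ _ _ stE)[_ ->].
Qed.

Lemma rings_of_two_largest : rings_of E [:: 995 / 100; 5] = two_largest.
Proof.
apply/setP => -[[|[|[|[|//]]]] lti]; rewrite !finset.inE /ring_radius /= ?eqxx ?orbT //;
by apply/negbTE; rewrite negb_or; apply/andP; split; apply/eqP; lra.
Qed.

Lemma rings_of_all_but_largest :
  rings_of E [:: 5; 43 / 10; 6 / 10] = all_but_largest.
Proof.
apply/setP => -[[|[|[|[|//]]]] lti]; rewrite !finset.inE /ring_radius /= ?eqxx ?orbT //.
by apply/negbTE; rewrite !negb_or; apply/and3P; split; apply/eqP; lra.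
Qed.

Lemma placed_greedy st : greedy_execution st ->
  placed st = two_largest.
Proof.
move=> /greedy_run_state stE; apply/setP => i; rewrite !finset.inE stE /greedy_state.
by case: ltnP.
Qed.

Lemma card_two_largest : #|two_largest| = 2%N.
Proof. by rewrite -sum1_card big_mkcond /= !big_ord_recl big_ord0 !finset.inE. Qed.

Lemma card_all_but_largest : #|all_but_largest| = 3%N.
Proof. by rewrite -sum1_card big_mkcond /= !big_ord_recl big_ord0 !finset.inE. Qed.

Lemma feasible_two_largest : feasible two_largest.
Proof.
exists greedy_parent; split=> [i j|c].
  rewrite !finset.inE /greedy_parent; case: eqVneq => // i0 i2 [<-]; split=> //.
  by case: i i0 i2 => [[|[|//]] ?] //= _ _; rewrite /ring_radius /=; lra.
have [[i [i2 ciE]]|nochild] := pselect (exists i, (i < 2)%N /\ c = greedy_parent i).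
  have -> : [set j in two_largest | greedy_parent j == c]%SET = [set i]%SET.
    apply/setP => j; rewrite !finset.inE ciE /greedy_parent !ring_eqE /=.
    by case: i i2 {ciE} => [[|[|//]] ?]; case: j => [[|[|[|[|//]]]] ?].
  by rewrite ciE; exact: packable_greedy_parent.
have -> : [set j in two_largest | greedy_parent j == c]%SET = finset.set0.
  apply/setP => j; rewrite !finset.inE; apply/negP => /andP[j2 /eqP jc].
  by apply: nochild; exists j.
exact: packable0.
Qed.

(** From left to right along a diameter, the rings of radii 5, 4.3 and 0.6
    touch each other and occupy the interval from -10 to 9.8. *)
Definition row_center i : K := [:: 0; -5; 43 / 10; 92 / 10]`_i.

Lemma packing_row :
  packing (pan_radius E) all_but_largest (fun i => (row_center i, 0)).
Proof.
apply: row_packing => [i _|i|i j]; first exact/ltW/ring_radius_gt0.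
  rewrite finset.inE; case: i => [[|[|[|[|//]]]] ?] //= _.
  - by rewrite /row_center /ring_radius /= normrN ger0_norm; lra.
  - by rewrite /row_center /ring_radius /= ger0_norm; lra.
  - by rewrite /row_center /ring_radius /= ger0_norm; lra.
rewrite !finset.inE ring_eqE /=; case: i => [[|[|[|[|//]]]] ?] //= _;
case: j => [[|[|[|[|//]]]] ?] //= _ _; rewrite /row_center /ring_radius /= ler_normr;
  apply/orP; (left; lra) || (right; lra).
Qed.

Lemma feasible_all_but_largest : feasible all_but_largest.
Proof.
exists (fun=> None); split=> // -[j|].
  rewrite (_ : [set _ in _ | _]%SET = finset.set0); first exact: packable0.
  by apply/setP => i; rewrite !finset.inE andbF.
rewrite (_ : [set _ in _ | _]%SET = all_but_largest).
  by exists (fun i => (row_center i, 0)); exact: packing_row.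
by apply/setP => i; rewrite !finset.inE eqxx andbT.
Qed.

Lemma ring0_fits_no_hole j : ring_radius j - width E < ring_radius ring0.
Proof. by case: j => [[|[|[|[|//]]]] ?]; rewrite /ring_radius /=; lra. Qed.

Lemma feasible_sub_two_largest T : feasible T -> ring0 \in T -> ring1 \in T ->
  T \subset two_largest.
Proof.
move=> [p [par pk]] T0 T1.
have p0 : p ring0 = None.
  case p0E : (p ring0) => [j|//]; have [_] := par _ _ T0 p0E.
  by rewrite leNgt ring0_fits_no_hole.
have p1 : p ring1 = Some ring0.
  apply: (parent_ring1 _ _ (pk (p ring1))) => [|p1E].
    by rewrite !finset.inE T1 eqxx.
  by rewrite finset.inE T0 p0 p1E.
apply/fintype.subsetP => i Ti; rewrite finset.inE ltnNge; apply/negP => small_i.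
have : i \in [set k in T | p k == p i]%SET by rewrite finset.inE Ti eqxx.
apply/negP/(no_room _ _ _ small_i (pk (p i))) => ->.
  by rewrite finset.inE T0 p0 eqxx.
by rewrite finset.inE T1 p1 eqxx.
Qed.

Lemma contactE i : contact (width E) (ring_radius i) =
  pi * [:: 7248 / 100; 2496 / 100; 1849 / 100; 36 / 100]`_i.
Proof.
rewrite /contact; congr (_ * _); case: i => [[|[|[|[|//]]]] ?] /=;
rewrite /hole_radius /ring_radius /=; (rewrite max_r; last by lra) || (rewrite max_l; last by lra); lra.
Qed.

(** Either [T] contains both of the largest rings, and then it contains nothing
    else, or it misses one of them; all rings but that one together have a
    smaller contact area, as 72.48 + 18.49 + 0.36 and 24.96 + 18.49 + 0.36 are
    both less than 72.48 + 24.96. *)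
Lemma contact_area_le_two_largest T : feasible T ->
  contact_area T <= contact_area two_largest.
Proof.
move=> fT; have pi0 := pi_gt0 K.
rewrite /contact_area [leLHS]big_mkcond [leRHS]big_mkcond /=.
have [/andP[T0 T1]|] := boolP ((ring0 \in T) && (ring1 \in T)).
  have /fintype.subsetP sub := feasible_sub_two_largest _ fT T0 T1.
  apply: ler_sum => i _; case: ifP => [/sub ->//|_]; case: ifP => // _.
  rewrite contactE pmulr_rge0 //.
  by case: i => [[|[|[|[|//]]]] ?] /=; lra.
have E0 : ord0 = ring0 by apply: val_inj.
have E1 : lift ord0 ord0 = ring1 by apply: val_inj.
rewrite !big_ord_recl !big_ord0 !contactE !finset.inE /= negb_and E1 E0.
case/orP => /negbTE ->; do ?[case: ifP => _]; lra.
Qed.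

Lemma valid_example : valid E.
Proof.
split=> /=; try lra.
by move=> r; rewrite !seq.in_cons seq.in_nil orbF => /or4P[] /eqP ->; lra.
Qed.

Lemma superincreasing_example : superincreasing E.
Proof.
move=> i; rewrite big_mkcond /= !big_ord_recl big_ord0.
by case: i => [[|[|[|[|//]]]] ?]; rewrite /ring_radius /=; lra.
Qed.

End Example.

Theorem proposition8 (K : realType) :
  (exists I : instance K,
     [/\ valid I, superincreasing I & greedy_suboptimal I]) /\
  (let I := example K in
   let G := rings_of I [:: 995 / 100; 5] in
   let S := rings_of I [:: 5; 43 / 10; 6 / 10] in
   [/\ valid I, superincreasing I & greedy_suboptimal I] /\
   (forall st : state I, greedy_execution st -> placed st = G) /\
   #|G| = 2%N /\
   (feasible G /\
    forall T : {set ring I}, feasible T -> contact_area T <= contact_area G) /\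
   no_choice I /\
   feasible S /\ #|S| = 3%N /\
   (exists x : ring I -> K * K,
      packing (pan_radius I) S x /\
      collinear [set x i | i in [set` S]]%classic)).
Proof.
have subopt : [/\ valid (example K), superincreasing (example K)
    & greedy_suboptimal (example K)].
  split; [exact: valid_example | exact: superincreasing_example |].
  move=> st /placed_greedy ->; exists [set i : ring (example K) | (0 < i)%N]%SET.
  by rewrite card_two_largest card_all_but_largest; split; first exact: feasible_all_but_largest.
split; first by exists (example K).
rewrite /= rings_of_two_largest rings_of_all_but_largest; split; first exact: subopt.
split; first exact: placed_greedy.
split; first exact: card_two_largest.
split; first by split; [exact: feasible_two_largest | exact: contact_area_le_two_largest].
split; first exact: greedy_no_choice.
split; first exact: feasible_all_but_largest.
split; first exact: card_all_but_largest.
exists (fun i => (row_center K i, 0)); split; first exact: packing_row.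
exists 0, 1, 0; split; first by right; rewrite oner_eq0.
by move=> _ [i _ <-] /=; rewrite mul0r mulr0 addr0.
Qed.
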